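(* Let $n\ge2$ and $d\ge1$, and let $K$ be the minimum number of generators of the set of $n$-antisymmetric polynomials in $\mathbb{R}[\boldsymbol{x}_1,\dots,\boldsymbol{x}_n]$ as a module over the ring of totally symmetric polynomials in $\mathbb{R}[\boldsymbol{x}_1,\dots,\boldsymbol{x}_n]$. Write $n$ uniquely as $n=\binom{r}{d}+j$ with $r\in\mathbb{Z}_{\ge0}$ and $0\le j<\binom{r}{d-1}$. Then $$\binom{\binom{r}{d-1}}{j}\;\le\;K\;\le\;\binom{\binom{n}{2}+dn}{dn}.$$
   Context: $\mathbb{R}[\boldsymbol{x}_1,\dots,\boldsymbol{x}_n]$ is the ring of real polynomials in the $dn$ coordinates $x_{ij}$, $1\le i\le n$, $1\le j\le d$, where $\boldsymbol{x}_i=(x_{i1},\dots,x_{id})$. For $\sigma\in\mathcal{S}_n$ (symmetric group), $\sigma.\boldsymbol{x}:=(\boldsymbol{x}_{\sigma(1)},\dots,\boldsymbol{x}_{\sigma(n)})$. A polynomial $f$ is totally symmetric if $f(\sigma.\boldsymbol{x})=f(\boldsymbol{x})$, and $n$-antisymmetric if $f(\sigma.\boldsymbol{x})=\mathrm{sgn}(\sigma)f(\boldsymbol{x})$, for all $\sigma\in\mathcal{S}_n$. *)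

(* Defs.v *)
From mathcomp Require Import all_boot all_order all_algebra all_fingroup.
From mathcomp Require Import reals.
From mathcomp Require Import mpoly.

Set Implicit Arguments.
Unset Strict Implicit.
Unset Printing Implicit Defensive.

Import GRing.Theory.
Local Open Scope ring_scope.

Section AntisymmetricPolynomials.
Variables (R : realType) (n d : nat).
Notation P := {mpoly R[n * d]}.

(* The point (x_1, ..., x_n) as an n x d matrix of indeterminates: row i is
   x_i, and x_ij is the variable of index mxvec_index i j. *)
Definition gen_point : 'M[P]_(n, d) := \matrix_(i, j) 'X_(mxvec_index i j).

Definition subst_point (f : P) (A : 'M[P]_(n, d)) : P :=
  f \mPo [tuple mxvec A 0 k | k < n * d].

(* Row i of row_perm s A is row s i of A, so this is f(s.x). *)
Definition subst_perm (s : 'S_n) (f : P) : P :=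
  subst_point f (row_perm s gen_point).

Definition totally_symmetric (f : P) : Prop :=
  forall s : 'S_n, subst_perm s f = f.

Definition n_antisymmetric (f : P) : Prop :=
  forall s : 'S_n, subst_perm s f = (-1) ^+ s * f.

End AntisymmetricPolynomials.

Section Generators.
Variables (A : comNzRingType) (S M : A -> Prop).

(* g generates M as a module over the subring S of A. *)
Definition generates (k : nat) (g : 'I_k -> A) : Prop :=
  (forall i, M (g i)) /\
  (forall f, M f -> exists c : 'I_k -> A,
     (forall i, S (c i)) /\ f = \sum_(i < k) c i * g i).

Definition generated_by (k : nat) : Prop :=
  exists g : 'I_k -> A, generates g.

Definition min_number_of_generators (k : nat) : Prop :=
  generated_by k /\ forall l : nat, generated_by l -> (k <= l)%N.

End Generators.

Definition binomial_decomposition (n d r j : nat) : Prop :=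
  n = ('C(r, d) + j)%N /\ (j < 'C(r, d.-1))%N.

(* Main.v *)
Require Import Defs.
From mathcomp Require Import all_boot all_order all_algebra all_fingroup.
From mathcomp Require Import boolp reals.
From mathcomp Require Import mpoly.

Set Implicit Arguments.
Unset Strict Implicit.
Unset Printing Implicit Defensive.

Import Order.TTheory GRing.Theory Num.Theory.
Local Open Scope ring_scope.

(** Upper bound.  Since n! is invertible, antisymmetrizing a family that spans
    all polynomials over the symmetric ones yields generators of the
    antisymmetric ones, so it suffices that the monomials of degree at most
    C(n,2) span.  Number the rows from 0 and let y_l be the value at x_l of a
    fixed linear form.  As the coefficients of prod_l (T - y_l) are symmetric,
    dividing by T - y_0, ..., T - y_(i-1) and evaluating at y_i expresses
    y_i^(n-i) through monomials which have lower degree, or the same degree and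
    variables moved to rows of smaller index.  Polarization extends this from
    powers of linear forms to all products of n-i variables of row i.  A monomial
    of degree above C(n,2) has n-i variables in some row i, so the rewriting
    stops only at degree C(n,2) or below.

    Lower bound.  Put e = r - d + 1.  A monomial of an antisymmetric polynomial
    has n distinct rows, hence degree at least that of a monomial m_J whose rows
    are all exponents of degree < e together with a set J of j exponents of
    degree e.  So the coefficient of m_J in sum_i c_i g_i only involves the
    constant terms of the c_i, and the identity matrix indexed by the sets J,
    which records the coefficients of m_J' in the antisymmetrized m_J, factors
    through R^K. *)

(** * Polarization: from powers of linear forms to products *)

Section PowersSpanProducts.
Variables (R : numFieldType) (A : comAlgType R) (V : A -> Prop).
Hypotheses (V0 : V 0) (VD : forall f g, V f -> V g -> V (f + g)).
Hypothesis VZ : forall (a : R) f, V f -> V (a *: f).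

Lemma closed_sum (I : Type) (r : seq I) (P : pred I) (F : I -> A) :
  (forall i, P i -> V (F i)) -> V (\sum_(i <- r | P i) F i).
Proof. by move=> VF; elim/big_ind: _. Qed.

(** The nodes 0, ..., N-1 are distinct in characteristic 0, so the inverse of their Vandermonde
    matrix recovers each coefficient from the values. *)
Lemma coef_mem_of_values (N : nat) (v : 'I_N -> A) :
  (forall t : R, V (\sum_(k < N) t ^+ k *: v k)) -> forall k, V (v k).
Proof.
move=> Vv k; pose a : 'rV[R]_N := \row_j j%:R.
have unitW : Vandermonde N a \in unitmx.
  rewrite unitmxE det_Vandermonde unitfE.
  apply/prodf_neq0 => i _; apply/prodf_neq0 => j ltij.
  by rewrite !mxE subr_eq0 eqr_nat neq_ltn ltij orbT.
have -> : v k = \sum_j invmx (Vandermonde N a) j k *: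
                  \sum_(l < N) (j%:R : R) ^+ l *: v l.
  under eq_bigr do rewrite scaler_sumr.
  have sumE (l : 'I_N) : \sum_j invmx (Vandermonde N a) j k *: ((j%:R : R) ^+ l *: v l) =
                (l == k)%:R *: v l.
    under eq_bigr do rewrite scalerA.
    rewrite -scaler_suml; congr (_ *: _).
    have /matrixP/(_ l k) := mulmxV unitW; rewrite !mxE => <-.
    by apply: eq_bigr => j _; rewrite !mxE mulrC.
  rewrite exchange_big /=; under eq_bigr do rewrite sumE.
  rewrite (bigD1 k) //= eqxx scale1r big1 ?addr0 // => l /negPf->.
  by rewrite scale0r.
by apply: closed_sum => j _; apply: VZ.
Qed.

Variable L : A -> Prop.
Hypothesis Llin : forall (t : R) u z, L u -> L z -> L (u + t *: z).

Lemma prod_mem_of_powers (m : nat) :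
  (0 < m)%N -> (forall z, L z -> V (z ^+ m)) ->
  forall s : seq A, (forall z, z \in s -> L z) -> size s = m ->
  V (\prod_(z <- s) z).
Proof.
move=> m_gt0 Vpow s Ls sz.
(* The factors [u] of [u ^+ m] are traded for arbitrary ones one at a time; [b] counts those already
   traded. *)
suff key : forall b (r : seq A), size r = b -> (b <= m)%N ->
    (forall z, z \in r -> L z) ->
    forall u, L u -> V (u ^+ (m - b) * \prod_(z <- r) z).
  case: s Ls sz => [|z s] Ls sz; first by rewrite -sz in m_gt0.
  have := key m (z :: s) sz (leqnn _) Ls z (Ls _ (mem_head _ _)).
  by rewrite subnn expr0 mul1r.
elim=> [|b IH] r; first by move/size0nil=> -> _ _ u Lu; rewrite subn0 big_nil mulr1; apply: Vpow.
case: r => // z r [szr] ltbm Lzr u Lu.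
have Lz : L z by apply: Lzr; rewrite mem_head.
have Lr : forall z, z \in r -> L z by move=> w wr; apply: Lzr; rewrite inE wr orbT.
set a := (m - b.+1)%N; have mb : (m - b = a.+1)%N by rewrite /a subnSK.
pose w (k : 'I_a.+2) := (u ^+ (a.+1 - k) * z ^+ k * \prod_(y <- r) y) *+ 'C(a.+1, k).
have Vw : forall k, V (w k).
  apply: coef_mem_of_values => t.
  have := IH r szr (ltnW ltbm) Lr _ (Llin t Lu Lz).
  rewrite mb exprDn mulr_suml; congr V; apply: eq_bigr => k _.
  by rewrite /w exprZn -scalerAr mulrnAl -scalerAl scalerMnr.
(* [lift ord0 ord0] is index 1: the coefficient of [t] in (u + t z)^(a+1) is (a+1) u^a z, and a+1 is
   invertible. *)
have := Vw (lift ord0 ord0); rewrite /w /= bin1 subn1 /= expr1 => /(VZ (a.+1%:R^-1)).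
rewrite -scaler_nat scalerA mulVf ?pnatr_eq0 // scale1r.
by rewrite big_cons mulrA.
Qed.

End PowersSpanProducts.

(** * Spans over the symmetric polynomials *)

Section SymmetricSpan.
Variables (R : realType) (n d : nat).
Notation P := {mpoly R[n * d]}.
Notation X i j := ('X_(mxvec_index i j) : P).
Notation sym := (@totally_symmetric R n d).

Definition mxvec_pair (k : 'I_(n * d)) : 'I_n * 'I_d :=
  enum_val (cast_ord (esym (mxvec_cast n d)) k).

Lemma mxvec_indexK i j : mxvec_pair (mxvec_index i j) = (i, j).
Proof. by rewrite /mxvec_pair /mxvec_index cast_ordK enum_rankK. Qed.

Lemma row_action_inj (s : 'S_n) :
  injective (fun k => mxvec_index (s (mxvec_pair k).1) (mxvec_pair k).2).
Proof.
move=> k l; case/mxvec_indexP: k => i j; case/mxvec_indexP: l => i' j'.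
rewrite !mxvec_indexK /= => /(congr1 mxvec_pair).
by rewrite !mxvec_indexK => -[/perm_inj-> ->].
Qed.

Definition row_action (s : 'S_n) : 'S_(n * d) := perm (@row_action_inj s).

Lemma row_actionE s i j : row_action s (mxvec_index i j) = mxvec_index (s i) j.
Proof. by rewrite permE mxvec_indexK. Qed.

Lemma row_actionM s t : row_action (s * t) = (row_action s * row_action t)%g.
Proof.
by apply/permP => k; case/mxvec_indexP: k => i j; rewrite permM !row_actionE permM.
Qed.

(** The substitution only renames variables, so the ring morphism [msym] can stand in for it
    throughout. *)
Lemma subst_permE s (f : P) : subst_perm s f = msym (row_action s) f.
Proof.
rewrite /subst_perm /subst_point /comp_mpoly /msym /mmap.
apply: eq_bigr => m _; congr (_ * _); apply: eq_bigr => k _; congr (_ ^+ _).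
by case/mxvec_indexP: k => i j; rewrite tnth_mktuple mxvecE !mxE row_actionE.
Qed.

Lemma subst_permX s i j : subst_perm s (X i j) = X (s i) j.
Proof. by rewrite subst_permE /msym mmapX mmap1U row_actionE. Qed.

Lemma subst_permM s t (f : P) :
  subst_perm s (subst_perm t f) = subst_perm (t * s)%g f.
Proof. by rewrite !subst_permE row_actionM msymMm. Qed.

Lemma sym0 : sym 0. Proof. by move=> s; rewrite subst_permE msym0. Qed.

Lemma symC (a : R) : sym a%:MP.
Proof. by move=> s; rewrite subst_permE -[a%:MP]mulr1 mul_mpolyC msymZ msym1. Qed.

Lemma sym1 : sym 1. Proof. exact: symC. Qed.

Lemma symD f g : sym f -> sym g -> sym (f + g).
Proof.
by move=> sf sg s; rewrite subst_permE msymD -!subst_permE sf sg.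
Qed.

Lemma symM f g : sym f -> sym g -> sym (f * g).
Proof.
by move=> sf sg s; rewrite subst_permE msymM -!subst_permE sf sg.
Qed.

(** A closure rather than explicit sums, so that rewriting steps carry no coefficient families;
    [symspan_finite] recovers the coefficients. *)
Inductive symspan (B : P -> Prop) : P -> Prop :=
| symspan0 : symspan B 0
| symspanD f g : symspan B f -> symspan B g -> symspan B (f + g)
| symspanM c f : sym c -> symspan B f -> symspan B (c * f)
| symspan_base f : B f -> symspan B f.

Lemma symspanZ B (a : R) f : symspan B f -> symspan B (a *: f).
Proof. by move=> Bf; rewrite -mul_mpolyC; apply: symspanM => //; apply: symC. Qed.

Lemma symspan_sum B (I : Type) (r : seq I) (Q : pred I) (F : I -> P) :
  (forall i, Q i -> symspan B (F i)) -> symspan B (\sum_(i <- r | Q i) F i).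
Proof.
by move=> BF; elim/big_ind: _ => //; [apply: symspan0 | apply: symspanD].
Qed.

Lemma symspan_mul B B' g :
  (forall f, B f -> symspan B' (g * f)) ->
  forall f, symspan B f -> symspan B' (g * f).
Proof.
move=> sub f; elim=> [|f1 f2 _ h1 _ h2|c f1 sc _ h|f1 Bf1]; last exact: sub.
- by rewrite mulr0; apply: symspan0.
- by rewrite mulrDr; apply: symspanD.
- by rewrite mulrCA; apply: symspanM.
Qed.

Lemma symspan_sub B B' :
  (forall f, B f -> symspan B' f) -> forall f, symspan B f -> symspan B' f.
Proof.
move=> sub f Bf; rewrite -[f]mul1r; apply: symspan_mul Bf => g Bg.
by rewrite mul1r; apply: sub.
Qed.

(* A monomial is a list of its variables, so that moving to lower rows is an
   operation on lists. *)
Definition mono (s : seq ('I_n * 'I_d)) : P := \prod_(p <- s) X p.1 p.2.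

Lemma mono_cat s t : mono (s ++ t) = mono s * mono t.
Proof. exact: big_cat. Qed.

Definition linform (a : 'I_d -> R) (l : 'I_n) : P := \sum_j a j *: X l j.

Lemma linform_mul_mono (B : P -> Prop) a l s :
  (forall j, B (mono ((l, j) :: s))) -> symspan B (linform a l * mono s).
Proof.
move=> Bs; rewrite mulr_suml; apply: symspan_sum => j _.
rewrite -scalerAl; apply/symspanZ/symspan_base.
by have := Bs j; rewrite /mono big_cons.
Qed.

Lemma linform_exp_mul_mono (B : P -> Prop) a l k s :
  (forall t, size t = k -> all (fun p => p.1 == l) t -> B (mono (t ++ s))) ->
  symspan B (linform a l ^+ k * mono s).
Proof.
elim: k s => [|k IH] s Bs; first by rewrite mul1r; apply/symspan_base/(Bs [::]).
rewrite exprSr -mulrA.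
have /symspan_mul : forall f, (exists j, f = mono ((l, j) :: s)) ->
  symspan B (linform a l ^+ k * f).
  move=> _ [j ->]; apply: IH => t szt allt; rewrite -cat_rcons.
  by apply: Bs; rewrite ?size_rcons ?szt // all_rcons eqxx.
by apply; apply: linform_mul_mono => j; exists j.
Qed.

(** * Reducing powers of a linear form *)

Section LinearForm.
Variable a : 'I_d -> R.

(** The quotient of the full product by its first [l] factors; a natural number [l] allows the empty
    product at [l = n]. *)
Definition tail_poly (l : nat) : {poly P} :=
  \prod_(i <- drop l (enum 'I_n)) ('X - (linform a i)%:P).

Lemma size_tail_poly l : size (tail_poly l) = (n - l).+1.
Proof. by rewrite size_prod_XsubC size_drop size_enum_ord. Qed.

Lemma tail_polyS (l : 'I_n) :
  tail_poly l = ('X - (linform a l)%:P) * tail_poly l.+1.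
Proof.
by rewrite /tail_poly (drop_nth l) ?size_enum_ord // big_cons nth_ord_enum.
Qed.

Lemma linform_perm s l : subst_perm s (linform a l) = linform a (s l).
Proof.
rewrite subst_permE /linform [LHS]linear_sum; apply: eq_bigr => j _.
by rewrite linearZ /= -subst_permE subst_permX.
Qed.

Lemma tail_poly0_sym k : sym (tail_poly 0)`_k.
Proof.
move=> s; rewrite subst_permE -coef_map; congr (polyseq _)`_k.
rewrite /tail_poly drop0 !big_enum /= rmorph_prod /=.
rewrite [RHS](reindex_inj (@perm_inj _ s)) /=; apply: eq_bigr => i _.
by rewrite rmorphB /= map_polyX map_polyC /= -subst_permE linform_perm.
Qed.

Definition low_mono (l k : nat) (f : P) : Prop :=
  exists s, [/\ f = mono s, (size s <= k)%N & all (fun p : 'I_n * 'I_d => (p.1 < l)%N) s].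

(* Modulo the positive-degree coefficients of [tail_poly 0], which are
   symmetric, these coefficients are the complete homogeneous polynomials in
   the first [l] forms. *)
Lemma coef_tail_poly l k : (l <= n)%N -> (k <= n - l)%N ->
  symspan (low_mono l k) (tail_poly l)`_(n - l - k).
Proof.
elim: l k => [|l IHl] k le_ln.
  move=> _; rewrite -[_`__]mulr1; apply: symspanM (tail_poly0_sym _) _.
  by apply: symspan_base; exists [::]; rewrite /mono big_nil.
elim: k => [|k IHk] le_k.
  have -> : (tail_poly l.+1)`_(n - l.+1 - 0) = 1.
    have /monicP := monic_prod_XsubC (drop l.+1 (enum 'I_n)) xpredT (linform a).
    by rewrite lead_coefE -/(tail_poly l.+1) size_tail_poly subn0.
  by apply: symspan_base; exists [::]; rewrite /mono big_nil.
pose i := Ordinal le_ln; set t := (n - l.+1 - k.+1)%N.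
have tS : (n - l.+1 - k = t.+1)%N by rewrite /t subnSK.
have tS' : (n - l - k.+1 = t.+1)%N by rewrite -tS -subnDA addnS -addSn subnDA.
(* Comparing coefficients in [tail_polyS] gives the recursion h_(k+1)(y_0..y_l) =
   h_(k+1)(y_0..y_(l-1)) + y_l h_k(y_0..y_l). *)
have -> : (tail_poly l.+1)`_t =
    (tail_poly l)`_(n - l - k.+1) + linform a i * (tail_poly l.+1)`_(n - l.+1 - k).
  rewrite tS tS' (tail_polyS i : tail_poly l = _) mulrBl coefB coefXM.
  by rewrite coefCM subrK.
apply: symspanD.
  have lek : (k.+1 <= n - l)%N by apply: leq_trans le_k _; apply: leq_sub2l.
  apply: symspan_sub (IHl _ (ltnW le_ln) lek) => _ [s [-> szs als]].
  apply: symspan_base; exists s; split=> //.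
  by apply: sub_all als => p /ltnW.
apply: symspan_mul (IHk (ltnW le_k)) => _ [s [-> szs als]].
apply: linform_mul_mono => j; exists ((i, j) :: s); split=> //=.
by rewrite ltnSn.
Qed.

(** The last clause records progress: the degree drops or some variable sits in an earlier row. *)
Definition reduced_mono (i m : nat) (f : P) : Prop :=
  exists s, [/\ f = mono s, (size s <= m)%N, all (fun p : 'I_n * 'I_d => (p.1 <= i)%N) s &
              (size s < m)%N || has (fun p : 'I_n * 'I_d => (p.1 < i)%N) s].

(** The form is a root of the monic [tail_poly a i] of degree n - i, whose coefficient of T^t
    involves only rows before [i], in degree at most n - i - t. *)
Lemma linform_exp_reduced (i : 'I_n) :
  symspan (reduced_mono i (n - i)) (linform a i ^+ (n - i)).
Proof.
set m := (n - i)%N.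
have lead1 : (tail_poly i)`_m = 1.
  have /monicP := monic_prod_XsubC (drop i (enum 'I_n)) xpredT (linform a).
  by rewrite lead_coefE -/(tail_poly i) size_tail_poly.
have : (tail_poly i).[linform a i] = 0.
  by rewrite tail_polyS hornerM hornerXsubC subrr mul0r.
rewrite horner_coef size_tail_poly big_ord_recr /= -/m lead1 mul1r.
move/eqP; rewrite addrC addr_eq0 => /eqP ->.
rewrite -scaleN1r; apply: symspanZ; apply: symspan_sum => t _.
have letm : (t <= m)%N := ltnW (ltn_ord t).
have -> : (tail_poly i)`_t = (tail_poly i)`_(n - i - (m - t)) by rewrite subKn.
rewrite mulrC.
have := coef_tail_poly (ltnW (ltn_ord i)) (leq_subr t m).
apply: symspan_mul => _ [s [-> szs als]].
apply: linform_exp_mul_mono => r szr allr; exists (r ++ s).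
rewrite size_cat szr all_cat has_cat; split=> //.
- by rewrite -leq_subRL.
- by apply/andP; split; [apply: sub_all allr => p /eqP-> | apply: sub_all als => p /ltnW].
(* If the coefficient contributes no variable, the degree is [t < m]; otherwise its first variable
   lies in a row before [i]. *)
case: s szs als => [|p s] szs /=; first by rewrite addn0 ltn_ord.
by case/andP=> -> _; rewrite !orbT.
Qed.

End LinearForm.

(** Polarization applies because the linear forms of row [i] are closed under u + t z and include
    each variable. *)
Lemma mono_reduced (i : 'I_n) s :
  size s = (n - i)%N -> all (fun p : 'I_n * 'I_d => p.1 == i) s ->
  symspan (reduced_mono i (n - i)) (mono s).
Proof.
move=> szs alls.
rewrite /mono -(big_map (fun p => X p.1 p.2) xpredT id).
apply: (@prod_mem_of_powers R P _ _ _ _ (fun z => exists a, z = linform a i) _ (n - i)).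
- exact: symspan0.
- exact: symspanD.
- exact: symspanZ.
- move=> t _ _ [a ->] [b ->]; exists (fun j => a j + t * b j).
  rewrite /linform scaler_sumr -big_split /=; apply: eq_bigr => j _.
  by rewrite scalerDl scalerA.
- by rewrite subn_gt0.
- by move=> _ [a ->]; apply: linform_exp_reduced.
- move=> _ /mapP[p ps ->]; exists (fun j => (j == p.2)%:R).
  rewrite /linform (bigD1 p.2) //= eqxx scale1r big1 ?addr0 => [|j /negPf->].
    by rewrite (eqP (allP alls p ps)).
  by rewrite scale0r.
- by rewrite size_map.
Qed.

Lemma crowded_row (s : seq ('I_n * 'I_d)) : ('C(n, 2) < size s)%N ->
  exists i : 'I_n, (n - i <= count (fun p : 'I_n * 'I_d => p.1 == i) s)%N.
Proof.
move=> lts; apply/existsP; move: lts; apply: contraLR => /existsPn few.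
rewrite -leqNgt.
have -> : size s = (\sum_(i < n) count (fun p : 'I_n * 'I_d => p.1 == i) s)%N.
  under eq_bigr do rewrite -sum1_count big_mkcond.
  rewrite exchange_big -sum1_size; apply: eq_bigr => p _ /=.
  by rewrite -big_mkcond /= (big_pred1 p.1) // => i; rewrite eq_sym.
(* If row [i] holds at most n - 1 - i variables for every [i], the total is at most 0 + ... +
   (n-1). *)
rewrite -bin2_sum big_mkord [leqRHS](reindex_inj rev_ord_inj) /=.
apply: leq_sum => i _; have := few i.
by rewrite -ltnNge subnS; case: (n - i)%N.
Qed.

Definition bounded_mono (b : nat) (f : P) : Prop :=
  exists s, f = mono s /\ (size s <= b)%N.

(** Rewriting terminates by induction on the degree, then on the sum of the row indices. *)
Lemma mono_bounded s : symspan (bounded_mono 'C(n, 2)) (mono s).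
Proof.
have [N] := ubnP (size s); elim: N s => // N IHN s.
have [w] := ubnP (\sum_(p <- s) p.1)%N; elim: w s => // w IHw s ltw ltN.
have [le_s|lt_s] := leqP (size s) 'C(n, 2).
  by apply: symspan_base; exists s.
have [i lei] := crowded_row lt_s.
pose q := [pred p : 'I_n * 'I_d | p.1 == i]; set m := (n - i)%N in lei.
pose s1 := take m (filter q s); pose s2 := drop m (filter q s) ++ filter (predC q) s.
have pss : perm_eq s (s1 ++ s2).
  by rewrite catA cat_take_drop perm_sym perm_filterC.
have sz1 : size s1 = m by rewrite size_takel // size_filter.
have al1 : all (fun p : 'I_n * 'I_d => p.1 == i) s1.
  apply/allP => p /mem_take; rewrite mem_filter => /andP[] //.
have -> : mono s = mono s2 * mono s1.
  by rewrite mulrC -mono_cat; apply: perm_big.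
apply: symspan_mul (mono_reduced sz1 al1) => _ [t [-> szt alt low]].
rewrite -mono_cat.
have szs : size s = (m + size s2)%N by rewrite (perm_size pss) size_cat sz1.
have [ltt|get] := ltnP (size t) m.
  apply: IHN; rewrite size_cat addnC; apply: (@leq_trans (size s)) => //.
  by rewrite szs ltn_add2r.
rewrite ltnNge get /= in low.
have st : size t = m by apply/eqP; rewrite eqn_leq szt get.
apply: IHw; last by rewrite size_cat st addnC -szs.
apply: (@leq_trans (\sum_(p <- s) p.1)%N) => //; rewrite (perm_big _ pss) /= !big_cat /=.
(* All of [s1] lies in row [i], whereas [t] has equally many variables in rows up to [i], one of
   them strictly earlier. *)
have -> : (\sum_(p <- s1) p.1 = m * i)%N.
  rewrite -sz1 mulnC -sum1_size big_distrr /= !big_seq; apply: eq_bigr => p ps.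
  by rewrite (eqP (allP al1 p ps)) muln1.
rewrite addnC ltn_add2r -st; elim: t alt low {szt get st} => //= p t IHt /andP[lep alt].
have le_t : (\sum_(p <- t) p.1 <= size t * i)%N.
  elim: t alt {IHt} => [|x t IHt] /=; first by rewrite big_nil.
  by case/andP=> lex /IHt let'; rewrite big_cons mulSn leq_add.
rewrite big_cons mulSn; have [ltp _|_] := ltnP p.1 i; first by rewrite -addSn leq_add.
by move=> /IHt -/(_ alt) lt_t; rewrite -addnS leq_add.
Qed.

Lemma symspan_bounded f : symspan (bounded_mono 'C(n, 2)) f.
Proof.
rewrite [f]mpolyE; apply: symspan_sum => m _; apply: symspanZ.
suff [s ->] : exists s, 'X_[m] = mono s by apply: mono_bounded.
exists (flatten [seq nseq (m k) (mxvec_pair k) | k <- enum 'I_(n * d)]).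
rewrite mpolyXE_id /mono big_flatten big_map big_enum /=; apply: eq_bigr => k _.
case/mxvec_indexP: k => i j; rewrite mxvec_indexK.
by rewrite big_nseq /= iter_mulr_1.
Qed.

End SymmetricSpan.

(** * The upper bound *)

Section Antisymmetrizer.
Variables (R : realType) (n d : nat).
Notation P := {mpoly R[n * d]}.
Notation sym := (@totally_symmetric R n d).
Notation antisym := (@n_antisymmetric R n d).

Definition antisymmetrize (f : P) : P := \sum_(s : 'S_n) (-1) ^+ s * subst_perm s f.

Lemma antisymmetrize_antisym f : antisym (antisymmetrize f).
Proof.
move=> t; rewrite subst_permE /antisymmetrize rmorph_sum mulr_sumr /=.
rewrite [RHS](reindex_inj (mulIg t)) /=; apply: eq_bigr => s _.
rewrite rmorphM rmorph_sign /= -subst_permE subst_permM mulrA odd_permM signr_addb.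
by rewrite mulrCA -signr_addb addbb mulr1.
Qed.

Lemma antisymmetrize0 : antisymmetrize 0 = 0.
Proof. by apply: big1 => s _; rewrite subst_permE msym0 mulr0. Qed.

Lemma antisymmetrizeD f g :
  antisymmetrize (f + g) = antisymmetrize f + antisymmetrize g.
Proof.
rewrite -big_split; apply: eq_bigr => s _.
by rewrite !subst_permE msymD mulrDr.
Qed.

Lemma antisymmetrizeM c f : sym c -> antisymmetrize (c * f) = c * antisymmetrize f.
Proof.
move=> sc; rewrite mulr_sumr; apply: eq_bigr => s _.
by rewrite subst_permE msymM -!subst_permE sc mulrCA.
Qed.

Lemma antisymmetrize_id f : antisym f -> antisymmetrize f = n`!%:R * f.
Proof.
move=> af; rewrite /antisymmetrize.
under eq_bigr do rewrite af mulrA -signr_addb addbb mul1r.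
by rewrite sumr_const card_Sn mulr_natl.
Qed.

Lemma symspan_finite (k : nat) (g : 'I_k -> P) f :
  symspan (fun h => exists i, h = g i) f ->
  exists c : 'I_k -> P, (forall i, sym (c i)) /\ f = \sum_(i < k) c i * g i.
Proof.
elim=> [|f1 f2 _ [c1 [s1 ->]] _ [c2 [s2 ->]]|c f1 sc _ [c1 [s1 ->]]|_ [i ->]].
- by exists (fun=> 0); split=> [_|]; [apply: sym0 | rewrite big1 // => i _; rewrite mul0r].
- exists (fun i => c1 i + c2 i); split=> [i|]; first exact: symD.
  by rewrite -big_split; apply: eq_bigr => i _; rewrite mulrDl.
- exists (fun i => c * c1 i); split=> [i|]; first exact: symM.
  by rewrite mulr_sumr; apply: eq_bigr => i _; rewrite mulrA.
exists (fun l => (l == i)%:R); split=> [l|].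
  by case: (l == i); [apply: sym1 | apply: sym0].
rewrite (bigD1 i) //= eqxx mul1r big1 ?addr0 // => l /negPf->.
by rewrite mul0r.
Qed.

Lemma mono_multinom (s : seq ('I_n * 'I_d)) :
  exists2 m : 'X_{1..n * d}, mono R s = 'X_[m] & mdeg m = size s.
Proof.
elim: s => [|p s [m mE degm]].
  by exists 0%MM; rewrite ?mdeg0 // mpolyX0 /mono big_nil.
exists (U_(mxvec_index p.1 p.2) + m)%MM; last by rewrite mdegD mdeg1 degm.
by rewrite mpolyXD -mE /mono big_cons.
Qed.

Lemma antisym_generated (b := 'C(n, 2)) :
  generated_by sym antisym 'C(n * d + b, n * d).
Proof.
(* Exponents of a monomial of degree at most [b] are at most [b], so [S] encodes all these
   monomials. *)
pose S := [set t : (n * d).-tuple 'I_b.+1 | (\sum_(i <- t) i <= b)%N].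
rewrite -card_partial_ord_partitions -/S.
pose X (t : (n * d).-tuple 'I_b.+1) : P := 'X_[[multinom tnth t k : nat | k < n * d]].
exists (fun i : 'I_#|S| => antisymmetrize (X (enum_val i))).
split=> [i|f af]; first exact: antisymmetrize_antisym.
suff [c [sc fE]] : exists c : 'I_#|S| -> P,
    (forall i, sym (c i)) /\ f = \sum_(i < #|S|) c i * X (enum_val i).
  exists (fun i => (n`!%:R^-1)%:MP * c i); split=> [i|].
    by apply: symM => //; apply: symC.
  (* On antisymmetric polynomials, antisymmetrizing multiplies by n!, which is divided out here. *)
  have -> : f = (n`!%:R^-1)%:MP * antisymmetrize f.
    rewrite (antisymmetrize_id af) -mpolyC_nat mulrA -mpolyCM mulVf ?mul1r //.
    by rewrite pnatr_eq0 -lt0n fact_gt0.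
  under [RHS]eq_bigr do rewrite -mulrA.
  rewrite -mulr_sumr {1}fE; congr (_ * _).
  rewrite (big_morph _ antisymmetrizeD antisymmetrize0).
  by apply: eq_bigr => i _; apply: antisymmetrizeM.
apply: symspan_finite; apply: symspan_sub (symspan_bounded f) => _ [s [-> szs]].
have [m -> degm] := mono_multinom s.
have mb k : (m k < b.+1)%N.
  by rewrite ltnS; apply: leq_trans szs; rewrite -degm mdegE (bigD1 k) //= leq_addr.
pose t : (n * d).-tuple 'I_b.+1 := [tuple inord (m k) | k < n * d].
have tE k : tnth t k = m k :> nat by rewrite tnth_mktuple inordK.
have St : t \in S.
  rewrite inE big_tuple; under eq_bigr do rewrite tE.
  by rewrite -mdegE degm.
apply: symspan_base; exists (enum_rank_in St t); rewrite enum_rankK_in // /X.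
by congr 'X_[_]; apply/mnmP => k; rewrite mnmE tE.
Qed.

End Antisymmetrizer.

(** * The lower bound *)

Section ExponentTuples.
Variables (d e : nat).
Notation T := (d.-tuple 'I_e.+1).

Definition exp_deg (t : T) : nat := \sum_(k < d) tnth t k.

(** Bounding entries by [e] excludes no exponent vector of degree at most [e]. *)
Definition exps_eq : {set T} := [set t | exp_deg t == e].
Definition exps_lt : {set T} := [set t | (exp_deg t < e)%N].

(** The truncated codegree vanishes off [exps_lt], so no set has a larger total than [exps_lt]. *)
Lemma sum_codeg_le (A : {set T}) :
  (\sum_(t in A) (e - exp_deg t) <= \sum_(t in exps_lt) (e - exp_deg t))%N.
Proof.
rewrite (bigID (mem exps_lt)) /= [X in (_ + X)%N]big1 ?addn0.
  rewrite big_mkcond [leqRHS]big_mkcond; apply: leq_sum => t _ /=.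
  by case: (t \in A); case: (t \in exps_lt).
by move=> t /andP[_]; rewrite inE -leqNgt -subn_eq0 => /eqP.
Qed.

(* Both families have total degree plus total codegree equal to [n * e]. *)
Lemma sum_exp_deg_min (n : nat) (r r0 : 'I_n -> T) :
  injective r -> injective r0 ->
  (forall i, exp_deg (r i) <= e)%N -> (forall i, exp_deg (r0 i) <= e)%N ->
  (forall t, t \in exps_lt -> exists i, r0 i = t) ->
  (\sum_i exp_deg (r0 i) <= \sum_i exp_deg (r i))%N.
Proof.
move=> injr injr0 le_r le_r0 r0lt.
have tot (q : 'I_n -> T) : (forall i, exp_deg (q i) <= e)%N ->
    (\sum_i exp_deg (q i) + \sum_i (e - exp_deg (q i)) = n * e)%N.
  move=> le_q; rewrite -big_split /= (eq_bigr (fun=> e)) => [|i _].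
    by rewrite sum_nat_const card_ord.
  exact: subnKC.
rewrite -(leq_add2r (\sum_i (e - exp_deg (r0 i)))%N) tot // -(tot r) // leq_add2l.
have imE (q : 'I_n -> T) : injective q ->
    (\sum_i (e - exp_deg (q i)) = \sum_(t in q @: setT) (e - exp_deg t))%N.
  by move=> injq; rewrite big_imset /= ?big_set //; move=> i j _ _ /injq.
rewrite imE // imE //; apply: leq_trans (sum_codeg_le _) _.
rewrite big_mkcond [leqRHS]big_mkcond; apply: leq_sum => t _ /=.
have [/r0lt[i <-]|//] := boolP (t \in exps_lt).
by rewrite imset_f.
Qed.

End ExponentTuples.

Lemma card_exps_eq d e : #|exps_eq d.+1 e| = 'C(d + e, d).
Proof.
rewrite -card_ord_partitions; apply: eq_card => t.
by rewrite !inE /exp_deg big_tuple.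
Qed.

(** Pascal's rule: the vectors of degree at most [e] number C(d+1+e, d+1), and those of degree
    exactly [e] number C(d+e, d). *)
Lemma card_exps_lt d e : #|exps_lt d.+1 e| = 'C(d + e, d.+1).
Proof.
have := card_partial_ord_partitions d.+1 e; rewrite addSn binS -card_exps_eq => cardle.
apply/eqP; rewrite -(eqn_add2r #|exps_eq d.+1 e|) -cardle -cardsUI.
have -> : exps_lt d.+1 e :&: exps_eq d.+1 e = set0.
  by apply/setP => t; rewrite !inE; case: ltngtP.
rewrite cards0 addn0; apply/eqP/eq_card => t.
by rewrite !inE /exp_deg big_tuple orbC -leq_eqVlt.
Qed.

(** * Coefficients of antisymmetric polynomials *)

Section LowerBound.
Variables (R : realType) (n d e : nat).
Notation P := {mpoly R[n * d]}.
Notation sym := (@totally_symmetric R n d).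
Notation antisym := (@n_antisymmetric R n d).
Notation T := (d.-tuple 'I_e.+1).

Lemma antisym_coef s (g : P) (m : 'X_{1..n * d}) : antisym g ->
  g@_[multinom m (row_action d s k) | k < n * d] = (-1) ^+ s * g@_m.
Proof.
move=> /(_ s); rewrite subst_permE => /(congr1 (mcoeff m)); rewrite mcoeff_sym => ->.
by rewrite !mulr_sign; case: (odd_perm s); rewrite ?mcoeffN.
Qed.

(** Swapping the two equal rows fixes the monomial but negates its coefficient. *)
Lemma antisym_coef_eq_rows (g : P) (m : 'X_{1..n * d}) (i i' : 'I_n) :
  antisym g -> i != i' ->
  (forall k, m (mxvec_index i k) = m (mxvec_index i' k)) -> g@_m = 0.
Proof.
move=> ag nii' eqm; have := antisym_coef (tperm i i') m ag.
have -> : [multinom m (row_action d (tperm i i') k) | k < n * d] = m.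
  apply/mnmP => k; rewrite mnmE; case/mxvec_indexP: k => l k; rewrite row_actionE.
  by case: tpermP => [->|->|].
rewrite odd_tperm nii' expr1 mulN1r => /eqP.
by rewrite -addr_eq0 -mulr2n mulrn_eq0 => /eqP.
Qed.

(** Among the factorizations of the monomial [m], only 1 times [m] itself survives. *)
Lemma coef_mul_lowest (c g : P) (m : 'X_{1..n * d}) :
  (forall k, (k <= m)%MM -> k != m -> g@_k = 0) -> (c * g)@_m = c@_0%MM * g@_m.
Proof.
move=> low; have lt0 : (mdeg (0%MM : 'X_{1..n * d}) < (mdeg m).+1)%N by rewrite mdeg0.
rewrite mcoeffM (bigD1 (BMultinom lt0, BMultinom (ltnSn (mdeg m)))) ?add0m //=.
rewrite big1 ?addr0 // => -[k1 k2] /= /andP[/eqP mE].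
have le2 : (bmnm k2 <= m)%MM by rewrite [X in (_ <= X)%MM]mE lem_addl.
have [k2E|/low -> //] := eqVneq (bmnm k2) m; last by rewrite mulr0.
rewrite xpair_eqE !bmeqP /= k2E eqxx andbT; case/eqP.
apply/mnmP => k; move/mnmP/(_ k): mE; rewrite mnmDE k2E mnm0E => /esym/eqP.
by rewrite -[X in _ == X]add0n eqn_add2r => /eqP.
Qed.

Definition mnm_of_rows (q : 'I_n -> T) : 'X_{1..n * d} :=
  [multinom tnth (q (mxvec_pair k).1) (mxvec_pair k).2 : nat | k < n * d].

Lemma mnm_of_rowsE q i k : mnm_of_rows q (mxvec_index i k) = tnth (q i) k.
Proof. by rewrite mnmE mxvec_indexK. Qed.

(** A proper divisor of a minimal monomial has too small a degree for its rows to be distinct. *)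
Lemma antisym_coef_below_minimal (q : 'I_n -> T) (g : P) : antisym g ->
  injective q -> (forall i, exp_deg (q i) <= e)%N ->
  (forall t, t \in exps_lt d e -> exists i, q i = t) ->
  forall m, (m <= mnm_of_rows q)%MM -> m != mnm_of_rows q -> g@_m = 0.
Proof.
move=> ag injq le_q qlt m lem neqm.
have leE i k : (m (mxvec_index i k) <= tnth (q i) k)%N.
  by rewrite -mnm_of_rowsE; apply/mnm_lepP.
(* Entries of [m] are bounded by those of [q], hence by [e], so [inord] does not alter them. *)
pose r i : T := [tuple inord (m (mxvec_index i k)) | k < d].
have rE i k : tnth (r i) k = m (mxvec_index i k) :> nat.
  by rewrite tnth_mktuple inordK // (leq_ltn_trans (leE i k)).
have [/injectiveP injr|/injectivePn[i [i' nii' eqr]]] := boolP (injectiveb r); last first.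
  by apply: (antisym_coef_eq_rows ag nii') => k; rewrite -!rE eqr.
have le_rq i : (exp_deg (r i) <= exp_deg (q i))%N.
  by apply: leq_sum => k _; rewrite rE.
case/negP: neqm; apply/eqP/mnmP => k; case/mxvec_indexP: k => i k.
have := sum_exp_deg_min injr injq (fun i => leq_trans (le_rq i) (le_q i)) le_q qlt.
rewrite /exp_deg !pair_bigA /= leqNgt => sum_ge.
apply/eqP; rewrite eqn_leq mnm_of_rowsE leE leqNgt; apply: contra sum_ge => lt_m.
rewrite (bigD1 (i, k)) //= [ltnRHS](bigD1 (i, k)) //= -addSn rE leq_add //.
by apply: leq_sum => -[i1 k1] _ /=; rewrite rE.
Qed.

(** Permuting the rows of a monomial preserves its set of rows. *)
Lemma antisymmetrize_coef (q q' : 'I_n -> T) : injective q ->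
  (antisymmetrize ('X_[mnm_of_rows q] : P))@_(mnm_of_rows q') != 0 ->
  q @: setT = q' @: setT.
Proof.
move=> injq; apply: contra_neq_eq => neqim.
rewrite raddf_sum big1 // => s _ /=; rewrite mulr_sign subst_permE.
suff cs0 : (msym (row_action d s) ('X_[mnm_of_rows q] : P))@_(mnm_of_rows q') = 0.
  by case: ifP; rewrite ?mcoeffN cs0 ?oppr0.
rewrite mcoeff_sym mcoeffX; case: eqP => // /mnmP eqm; case/eqP: neqim.
have qE i : q i = q' (s i).
  apply: eq_from_tnth => k; apply: val_inj => /=.
  by have := eqm (mxvec_index i k); rewrite mnm_of_rowsE mnmE row_actionE mnm_of_rowsE.
apply/setP => t; apply/imsetP/imsetP => -[i _ ->].
  by exists (s i).
by exists (s^-1 i)%g; rewrite // qE permKV.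
Qed.

(** As the rows are distinct, only the identity fixes the monomial. *)
Lemma antisymmetrize_coef_diag (q : 'I_n -> T) : injective q ->
  (antisymmetrize ('X_[mnm_of_rows q] : P))@_(mnm_of_rows q) = 1.
Proof.
move=> injq; rewrite raddf_sum (bigD1 1%g) //= odd_perm1 mul1r big1 => [|s neqs1].
  rewrite addr0 subst_permE mcoeff_sym mcoeffX.
  case: eqP => // -[]; apply/mnmP => k; rewrite mnmE.
  by case/mxvec_indexP: k => i k; rewrite row_actionE perm1.
rewrite mulr_sign subst_permE.
suff cs0 : (msym (row_action d s) ('X_[mnm_of_rows q] : P))@_(mnm_of_rows q) = 0.
  by case: ifP; rewrite ?mcoeffN cs0 ?oppr0.
rewrite mcoeff_sym mcoeffX; case: eqP => // /mnmP eqm; case/eqP: neqs1.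
apply/permP => i; rewrite perm1; apply/esym/injq/eq_from_tnth => k; apply: val_inj => /=.
by have := eqm (mxvec_index i k); rewrite mnm_of_rowsE mnmE row_actionE mnm_of_rowsE.
Qed.

Lemma generators_lower_bound (j l : nat) : n = (#|exps_lt d e| + j)%N ->
  generated_by sym antisym l -> ('C(#|exps_eq d e|, j) <= l)%N.
Proof.
move=> nE [g [ag gen]].
pose Js := [set J : {set T} | J \subset exps_eq d e & #|J| == j].
rewrite -cards_draws -/Js.
pose E (J : {set T}) := exps_lt d e :|: J.
have disj (J : {set T}) : J \subset exps_eq d e -> [disjoint exps_lt d e & J].
  move=> sJ; apply/pred0P => t /=; apply/negbTE/negP => /andP[lt_t /(subsetP sJ)].
  by move: lt_t; rewrite !inE => lt_t /eqP tE; rewrite tE ltnn in lt_t.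
have cardE (a : 'I_#|Js|) : n = #|E (enum_val a)|.
  have := enum_valP a; rewrite inE => /andP[sJ /eqP cJ].
  have := disj _ sJ; rewrite -leq_card_setU => /eqP->.
  by rewrite cJ nE.
pose q a i := enum_val (cast_ord (cardE a) i).
have injq a : injective (q a) by move=> i i' /enum_val_inj/cast_ord_inj.
have imq a : q a @: setT = E (enum_val a).
  apply/setP => t; apply/imsetP/idP => [[i _ ->]|Et]; first exact: enum_valP.
  exists (cast_ord (esym (cardE a)) (enum_rank_in Et t)) => //.
  by rewrite /q cast_ordKV enum_rankK_in.
have le_q a i : (exp_deg (q a i) <= e)%N.
  have : q a i \in E (enum_val a) by rewrite -imq imset_f.
  have := enum_valP a; rewrite inE => /andP[/subsetP sJ _].
  by case/setUP => [|/sJ]; rewrite inE; [move/ltnW | move/eqP->].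
have qlt a t : t \in exps_lt d e -> exists i, q a i = t.
  move=> ltt; have : t \in q a @: setT by rewrite imq inE ltt.
  by case/imsetP => i _ ->; exists i.
(* [J] is recovered from [E J] as its part of degree exactly [e]. *)
have inj_im a a' : q a @: setT = q a' @: setT -> a = a'.
  rewrite !imq => eqE; apply: enum_val_inj.
  have EK (b : 'I_#|Js|) : E (enum_val b) :&: exps_eq d e = enum_val b.
    have := enum_valP b; rewrite inE => /andP[sJ _].
    apply/setP => t; rewrite in_setI in_setU.
    have [/(subsetP sJ)->|_] := boolP (t \in enum_val b); first by rewrite orbT.
    by rewrite orbF !inE; case: ltngtP.
  by rewrite -(EK a) eqE EK.
have /choice[c hc] : forall a, exists c : 'I_l -> P, (forall i, sym (c i)) /\
    antisymmetrize 'X_[mnm_of_rows (q a)] = \sum_(i < l) c i * g i.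
  by move=> a; apply: gen; apply: antisymmetrize_antisym.
(* [C] holds the constant terms of the coefficients; [C *m G] being the identity forces
   [#|Js| <= l]. *)
pose C := \matrix_(a < #|Js|, i < l) (c a i)@_0%MM.
pose G := \matrix_(i < l, a < #|Js|) (g i)@_(mnm_of_rows (q a)).
apply: (@mulmx1_min _ _ _ C G); apply/matrixP => a a'; rewrite !mxE.
transitivity (antisymmetrize ('X_[mnm_of_rows (q a)] : P))@_(mnm_of_rows (q a')).
  rewrite (hc a).2 raddf_sum; apply: eq_bigr => i _ /=; rewrite !mxE.
  by rewrite coef_mul_lowest //; apply: antisym_coef_below_minimal (qlt a').
have [<-|neqa] := eqVneq a a'; first exact: antisymmetrize_coef_diag.
apply/eqP; apply: contraNT neqa => /(antisymmetrize_coef (@injq a))/inj_im->.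
by [].
Qed.

End LowerBound.

(** * Existence and uniqueness of the binomial decomposition *)

(** By Pascal's rule the condition on [j] says n < C(r+1, d), so [r] is the largest integer with
    C(r, d) at most n. *)
Lemma binomial_decomposition_uniq (n d : nat) : (0 < d)%N ->
  exists! rj : nat * nat, binomial_decomposition n d rj.1 rj.2.
Proof.
case: d => // d _; rewrite /binomial_decomposition /=.
have ex0 : exists r, ('C(r, d.+1) <= n)%N by exists 0%N.
(* The maximum exists because C(n+d+1, d+1) = C(n+d+1, n) is at least C(n+1, n) = n+1. *)
have bnd r : ('C(r, d.+1) <= n)%N -> (r <= n + d.+1)%N.
  apply: contraLR; rewrite -!ltnNge => lt_r.
  apply: (@leq_trans 'C(n + d.+1, d.+1)).
    by rewrite -bin_sub ?leq_addl // addnK -[leqLHS]binSn leq_bin2l // addnS ltnS leq_addr.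
  exact: leq_bin2l (ltnW lt_r).
case: (ex_maxnP ex0 bnd) => r le_r max_r.
have ltS : (n < 'C(r.+1, d.+1))%N.
  by rewrite ltnNge; apply/negP => /max_r; rewrite ltnn.
exists (r, n - 'C(r, d.+1))%N; split=> /= [|[r' j'] /= [nE lt_j']].
  by rewrite subnKC // ltn_subLR // -binS.
have le_r' : (r' <= r)%N by apply: max_r; rewrite nE leq_addr.
have -> : r = r'.
  apply/eqP; rewrite eqn_leq le_r' andbT leqNgt; apply/negP => /(leq_bin2l d.+1).
  rewrite leqNgt; case/negP; apply: leq_ltn_trans le_r _.
  by rewrite nE binS ltn_add2l.
by rewrite {1}nE addKn.
Qed.

Theorem mainTheorem6 (R : realType) (n d : nat) (hn : (2 <= n)%N)
    (hd : (1 <= d)%N) :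
  (exists! rj : nat * nat, binomial_decomposition n d rj.1 rj.2) /\
  exists K : nat,
    min_number_of_generators
      (@totally_symmetric R n d) (@n_antisymmetric R n d) K /\
    forall r j : nat, binomial_decomposition n d r j ->
      ('C('C(r, d.-1), j) <= K <= 'C('C(n, 2) + d * n, d * n))%N.
Proof.
split; first exact: binomial_decomposition_uniq.
case: d hd => // d _.
pose gen k := generated_by (@totally_symmetric R n d.+1) (@n_antisymmetric R n d.+1) k.
have gen_top : gen 'C(n * d.+1 + 'C(n, 2), n * d.+1) := @antisym_generated R n d.+1.
have exgen : exists k, `[< gen k >] by exists 'C(n * d.+1 + 'C(n, 2), n * d.+1); apply/asboolP.
case: (ex_minnP exgen) => K /asboolP genK minK.
exists K; split; first by split=> // l genl; apply/minK/asboolP.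
move=> r j [nE lt_j]; apply/andP; split; last first.
  by rewrite addnC mulnC; apply/minK/asboolP.
rewrite /= in lt_j.
(* Here [d] is one less than in the statement. As C(r, d) exceeds [j], it is nonzero, so [r - d],
   the [e] of the lower bound, is not truncated. *)
have le_dr : (d <= r)%N by rewrite leqNgt; apply: contraL lt_j => /bin_small->.
have rE : r = (d + (r - d))%N by rewrite subnKC.
have eqE := card_exps_eq d (r - d); have ltE := card_exps_lt d (r - d).
rewrite -rE in eqE ltE.
by rewrite -eqE; apply: generators_lower_bound genK; rewrite ltE.
Qed.
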